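(* Let $\delta>0$ and let $p\in\mathbb{Z}[x]$ satisfy $\lim_{x\to+\infty}p(x)=+\infty$. Suppose that $p(n)$ is even for some $n\in\mathbb{N}$. Then there exist $b,d\in\mathbb{N}$ such that, for every $A\subseteq\mathbb{N}$ satisfying $$\overline{d}_{b+d\mathbb{N}}(A):=\limsup_{N\to\infty}\frac{\left|A\cap\{b+d,b+2d,\dots,b+Nd\}\right|}{N}>\delta,$$ there exist distinct $x,y\in A$ such that $x+y=p(n)$ for some $n\in\mathbb{N}$.
   Context: $\mathbb{N}=\{1,2,\dots\}$. *)

(* Defs.v *)
From HB Require Import structures.
From mathcomp Require Import all_boot all_order all_algebra finmap.
From mathcomp Require Import all_classical all_reals all_analysis.

Set Implicit Arguments.
Unset Strict Implicit.
Unset Printing Implicit Defensive.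

Import Order.TTheory GRing.Theory Num.Theory.
Import numFieldNormedType.Exports.

Local Open Scope classical_set_scope.
Local Open Scope ring_scope.

(* {b + d, b + 2d, ..., b + Nd} *)
Definition ap_segment (b d N : nat) : set nat :=
  [set (b + k * d)%N | k in [set k : nat | (1 <= k <= N)%N]].

(* The term at N = 0 has the value 0 / 0 = 0; it does not affect the limsup.
   For finite sets, such as the one below, [fset_set] is the same set seen as
   a finite set of [finmap], so that [#|` _|] is its cardinality. *)
Definition upper_density_ap (R : realType) (b d : nat) (A : set nat) : \bar R :=
  limn_esup (fun N : nat =>
    ((#|` fset_set (A `&` ap_segment b d N)|)%fset%:R / N%:R : R)%:E).

(* Main.v *)
Require Import Defs.
From mathcomp Require Import all_boot all_order all_algebra finmap.
From mathcomp Require Import all_classical all_reals all_analysis.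
From mathcomp Require Import zify ring lra.
Import Order.TTheory GRing.Theory Num.Theory.
Import numFieldNormedType.Exports.
Local Open Scope classical_set_scope.
Local Open Scope ring_scope.

(* Shifting the variable by a large n0 makes all coefficients P_j of p(n0 + x) positive.
   With cc = P_1, a suitable multiple K of cc, b = P_0 / 2, e = cc K and d = cc e, one gets
   p(n0 + e m) = 2b + d q(m), where q(m) = m + K (...) is a polynomial with natural
   coefficients; so if b + d U is contained in A, it suffices to find distinct u, v in U with
   u + v = q(m). The map q permutes the residues modulo every D dividing a power of K.
   By Weyl's inequality the exponential sum of q is therefore small except near 0: large
   values occur only near rationals of bounded denominator times the leading coefficient,
   and if K is sufficiently divisible the complete sums at the nonzero ones vanish.
   Hence the points q(m), weighted by q(m + 1) - q(m), have nearly the same Fourier transform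
   as an interval, and the weighted number of solutions of u + v = q(m) is close to |U|^2.
   The order of choices matters: delta and the degree give the accuracy, then the multiplier
   in Weyl's inequality, then K, and only then the threshold for the size of U. *)

(** * Trigonometric sums *)

Lemma dist_cos_le {R : realType} (x y : R) : `|cos x - cos y| <= `|x - y|.
Proof.
wlog lexy : x y / x <= y.
  by move=> H; case: (leP x y) => [/H //|/ltW /H]; rewrite distrC [in X in _ <= X]distrC.
have dcos (z : R) : z \in `]x, y[ -> is_derive z 1 cos (- sin z).
  by move=> _; exact: is_derive_cos.
have [|c _ E] := @MVT_segment R cos (fun z => - sin z) x y lexy dcos.
  by apply: continuous_subspaceT; exact: continuous_cos.
rewrite distrC E normrM normrN (distrC x) ler_piMl//; exact: sin_max.
Qed.

(** By the double angle formula and the mean value theorem, [sin x] is at least $x\cos^2(x/2)$, and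
    $2\cos^2(x/2)=1+\cos x\ge 1$. *)
Lemma ler_half_sin {R : realType} (x : R) : 0 <= x <= pi / 2 -> x / 2 <= sin x.
Proof.
move=> /andP[x0 xpi].
have pi0 := pi_gt0 R.
have dsin (z : R) : z \in `]0, (x / 2)[ -> is_derive z 1 sin (cos z).
  by move=> _; exact: is_derive_sin.
have x20 : 0 <= x / 2 by lra.
have [|c] := @MVT_segment R sin cos 0 (x / 2) x20 dsin.
  by apply: continuous_subspaceT; exact: continuous_sin.
rewrite in_itv/= sin0 !subr0 => /andP[c0 cx] E.
have cc : cos (x / 2) <= cos c.
  rewrite -[_ <= _]negbK -ltNge; apply/negP.
  rewrite ltr_cos ?in_itv/=; lra.
have c1 : 0 <= cos (x / 2) by apply: cos_ge0_pihalf; lra.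
have x2E : x = (x / 2) *+ 2 by lra.
rewrite [in X in _ <= X]x2E sin_mulr2n E.
have cx0 : 0 <= cos x by apply: cos_ge0_pihalf; lra.
have : 1 <= cos (x / 2) ^+ 2 *+ 2.
  by move: cx0; rewrite x2E cos_mulr2n -x2E; lra.
move: (cos (x / 2)) (cos c) cc c1 => u v uv u0; rewrite expr2 => u1.
have : u * u <= u * v by apply: ler_wpM2l.
have : 0 <= x / 2 * (u * v - 1/2) -> x / 2 <= (u * (v * (x / 2))) *+ 2 by nra.
by move=> + H; apply; apply: mulr_ge0 => //; lra.
Qed.


(** Real and imaginary parts of $e(t)=\exp(2\pi i t)$. Exponential sums are handled through their
    real parts with an arbitrary added phase; a quarter turn of the phase recovers the imaginary
    part. *)
Definition ecos {R : realType} (t : R) : R := cos (2 * pi * t).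
Definition esin {R : realType} (t : R) : R := sin (2 * pi * t).

Lemma ecos_le1 {R : realType} (t : R) : `|ecos t| <= 1.
Proof. exact: cos_max. Qed.

Lemma ecosD {R : realType} (x y : R) :
  ecos (x + y) = ecos x * ecos y - esin x * esin y.
Proof. by rewrite /ecos mulrDr cosD. Qed.

Lemma esinD {R : realType} (x y : R) :
  esin (x + y) = esin x * ecos y + ecos x * esin y.
Proof. by rewrite /esin mulrDr sinD. Qed.

Lemma ecosB {R : realType} (x y : R) :
  ecos (x - y) = ecos x * ecos y + esin x * esin y.
Proof. by rewrite /ecos mulrBr cosB. Qed.

Lemma ecosDquarter {R : realType} (x : R) : ecos (x + 1 / 4) = - esin x.
Proof.
rewrite /ecos /esin -cosDpihalf; congr cos; lra.
Qed.

Lemma ecos0 {R : realType} : ecos (0 : R) = 1.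
Proof. by rewrite /ecos mulr0 cos0. Qed.

Lemma ecosDn {R : realType} (x : R) (n : nat) : ecos (x + n%:R) = ecos x.
Proof.
rewrite /ecos -(periodicn (@cosD2pi R) n (2 * pi * x)); congr cos.
by rewrite mulrDr -[pi *+ 2 *+ n]mulr_natr -[pi *+ 2]mulr_natr (mulrC _ 2).
Qed.

Lemma ecosDz {R : realType} (x : R) (a : int) : ecos (x + a%:~R) = ecos x.
Proof.
case: a => n; first exact: ecosDn.
by rewrite -(ecosDn _ n.+1) NegzE mulrNz subrK.
Qed.

Lemma dist_ecos_le {R : realType} (x y : R) : `|ecos x - ecos y| <= 8 * `|x - y|.
Proof.
apply: le_trans (dist_cos_le _ _) _; rewrite -mulrBr normrM ger0_norm.
  by apply: ler_wpM2r => //; have := pihalf_lt2 R; lra.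
by have := pi_ge0 R; lra.
Qed.

(** Multiplied by $2\sin(\pi\alpha)$, each cosine becomes a difference of sines at two consecutive
    half-steps. *)
Lemma sum_ecos_telescope {R : realType} (alpha beta : R) (M : nat) :
  2 * sin (pi * alpha) * \sum_(m < M) ecos (alpha * m%:R + beta) =
  esin (alpha * M%:R - alpha / 2 + beta) - esin (beta - alpha / 2).
Proof.
elim: M => [|M IH].
  by rewrite big_ord0 mulr0 mulr0 sub0r (addrC (- _)) subrr.
rewrite big_ord_recr/= mulrDr IH.
have -> : sin (pi * alpha) = esin (alpha / 2) by rewrite /esin; congr sin; lra.
have -> : alpha * M%:R - alpha / 2 + beta = (alpha * M%:R + beta) + - (alpha / 2) by lra.
have -> : alpha * M.+1%:R - alpha / 2 + beta = (alpha * M%:R + beta) + alpha / 2.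
  by rewrite -natr1; lra.
rewrite !esinD /ecos /esin !mulrN cosN sinN; ring.
Qed.

Lemma exists_near_int {R : realType} (x : R) : exists a : int, `|x - a%:~R| <= 1 / 2.
Proof.
exists (Num.floor (x + 1 / 2)).
have := floor_itv (x + 1 / 2); rewrite intrD mulr1z => /andP[].
by move=> H1 H2; rewrite ler_norml; lra.
Qed.

Lemma le_norm_sinpi {R : realType} (t : R) : `|t| <= 1 / 2 -> `|t| <= `|sin (pi * t)|.
Proof.
wlog t0 : t / 0 <= t.
  move=> H; case: (leP 0 t) => [/H //|/ltW t0] tle.
  by have := H (- t); rewrite oppr_ge0 !normrN mulrN sinN normrN; apply.
have pi2 := pi_ge2 R.
rewrite (ger0_norm t0) => tle.
apply: le_trans (ler_norm _); apply: le_trans (ler_half_sin _ _); nra.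
Qed.

Lemma norm_sinpiBz {R : realType} (t : R) (a : int) :
  `|sin (pi * (t - a%:~R))| = `|sin (pi * t)|.
Proof.
have Hn (u : R) (n : nat) : `|sin (pi * (u + n%:R))| = `|sin (pi * u)|.
  rewrite mulrDr mulr_natr; elim: n => [|n IH]; first by rewrite mulr0n addr0.
  by rewrite mulrSr addrA sinDpi normrN.
case: a => n; last by rewrite NegzE mulrNz opprK Hn.
by rewrite -(Hn _ n) subrK.
Qed.

(** The telescoped sum is at most 2, and $|\sin\pi\alpha|$ is at least the distance from $\alpha$ to
    the nearest integer [a]; one [a] serves all phases and lengths. *)
Lemma sum_ecos_linear_le {R : realType} (alpha : R) : exists2 a : int,
  `|alpha - a%:~R| <= 1 / 2 &
  forall beta M, `|alpha - a%:~R| * `|\sum_(m < M) ecos (alpha * m%:R + beta)| <= 1.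
Proof.
have [a ha] := exists_near_int alpha; exists a => // beta M.
have := sum_ecos_telescope alpha beta M.
move=> /(congr1 Num.norm); rewrite 2!normrM normr_nat -(norm_sinpiBz _ a).
have := le_norm_sinpi _ ha.
have S2 x y : `|esin x - esin y : R| <= 2.
  apply: le_trans (ler_normB _ _) _.
  by have := sin_max (2 * pi * x); have := sin_max (2 * pi * y); rewrite -/(esin _) -/(esin _); lra.
have := S2 (alpha * M%:R - alpha / 2 + beta) (beta - alpha / 2).
move: `|esin _ - _| `|sin _| `|alpha - _| (normr_ge0 (\sum_(m < M) ecos (alpha * m%:R + beta))).
move: `|\sum_(_ < _) _| => S e s d S0 e2 sd E; nra.
Qed.

(** The end points of the telescoped sum differ by the integer [a], so it vanishes, while $\sin(\pi
    a/D)\ne 0$. *)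
Lemma sum_ecos_full_period {R : realType} (D : nat) (a : int) (beta : R) :
  (0 < D)%N -> ~~ (D%:Z %| a)%Z ->
  \sum_(m < D) ecos (a%:~R / D%:R * m%:R + beta) = 0.
Proof.
move=> D0 Da; set al := a%:~R / D%:R.
have DR : D%:R != 0 :> R by rewrite pnatr_eq0 -lt0n.
have := sum_ecos_telescope al beta D.
have -> : al * D%:R - al / 2 + beta = beta - al / 2 + a%:~R.
  by rewrite /al mulfVK//; ring.
have -> x : esin (x + a%:~R) = esin x :> R.
  by rewrite -[esin _]opprK -[esin x]opprK -!ecosDquarter addrAC ecosDz.
rewrite subrr => /eqP; rewrite mulf_eq0 => /orP[|/eqP//].
rewrite mulf_eq0 (negbTE (_ : 2%:R != 0)) ?pnatr_eq0//= => /eqP s0; exfalso.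
have [b hb] := exists_near_int al.
have := le_norm_sinpi _ hb; rewrite norm_sinpiBz s0 normr0 normr_le0 subr_eq0.
rewrite /al => /eqP E.
have {}E : a%:~R = b%:~R * D%:R :> R by rewrite -E mulfVK.
have /eqP : a%:~R = (b * D%:Z)%:~R :> R by rewrite intrM E.
by rewrite eqr_int => /eqP Eab; move: Da; rewrite Eab dvdz_mull.
Qed.

(** * Weyl's inequality *)

Lemma sum_pairs_by_difference {V : zmodType} (g : nat -> nat -> V) (M : nat) :
  \sum_(h < M) \sum_(m < M - h) g (m + h)%N m =
  \sum_(m < M) \sum_(m' < m.+1) g m m'.
Proof.
elim: M => [|M IH]; first by rewrite !big_ord0.
rewrite [RHS]big_ord_recr/= -IH.
rewrite big_ord_recr/= subSn// subnn big_ord1/= add0n.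
have -> : \sum_(h < M) \sum_(m < M.+1 - h) g (m + h)%N m =
    \sum_(h < M) \sum_(m < M - h) g (m + h)%N m + \sum_(h < M) g M (M - h)%N.
  rewrite -big_split/=; apply: eq_bigr => h _.
  by rewrite subSn 1?ltnW// big_ord_recr/= subnK 1?ltnW.
rewrite -addrA; congr (_ + _); rewrite [RHS]big_ord_recl/= addrC; congr (_ + _).
rewrite (reindex_inj rev_ord_inj)/=; apply: eq_bigr => h _; congr (g _ _).
by rewrite /bump/= add1n subKn.
Qed.

(* The cosine sum is the real part of an exponential sum [S], and [|S|^2] expands into
   a double sum, grouped here by the difference of the two indices. *)
Lemma van_der_Corput {R : realType} (f : nat -> R) (M : nat) :
  (\sum_(m < M) ecos (f m)) ^+ 2 <=
  2 * \sum_(h < M) `|\sum_(m < M - h) ecos (f (m + h)%N - f m)|.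
Proof.
pose g m m' := ecos (f m - f m').
have gC m m' : g m m' = g m' m by rewrite /g !ecosB; ring.
have -> : 2 * \sum_(h < M) `|\sum_(m < M - h) ecos (f (m + h)%N - f m)|
   = \sum_(h < M) 2 * `|\sum_(m < M - h) g (m + h)%N m| by rewrite mulr_sumr.
apply: (@le_trans _ _ (\sum_(m < M) \sum_(m' < M) g m m')).
  have -> : \sum_(m < M) \sum_(m' < M) g m m' =
     (\sum_(m < M) ecos (f m)) ^+ 2 + (\sum_(m < M) esin (f m)) ^+ 2.
    rewrite !expr2 !mulr_suml -big_split/=; apply: eq_bigr => m _.
    rewrite !mulr_sumr -big_split/=; apply: eq_bigr => m' _.
    by rewrite /g ecosB.
  by rewrite lerDl sqr_ge0.
(* By symmetry of [g], doubling the triangle counts every pair and the diagonal, whose terms are 1,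
   twice. *)
apply: (@le_trans _ _ (\sum_(m < M) (\sum_(m' < m.+1) g m m') *+ 2)).
  elim: M => [|M IH]; first by rewrite !big_ord0.
  rewrite big_ord_recr/= [leRHS]big_ord_recr/=.
  under eq_bigr do rewrite big_ord_recr/=.
  rewrite big_split/= big_ord_recr/=.
  under [\sum_(i < M) g i M]eq_bigr do rewrite gC.
  have := IH; set a := \sum_(_ < M) _; set b := \sum_(_ < M) _; set c := \sum_(_ < M) _.
  have -> : g M M = 1 by rewrite /g subrr ecos0.
  rewrite mulr2n; lra.
rewrite sumrMnl -sum_pairs_by_difference -sumrMnl; apply: ler_sum => h _.
by rewrite -[leLHS]mulr_natl ler_wpM2l// ler_norm.
Qed.

Lemma pigeonhole_lt (M T : nat) (G : pred 'I_M) (f : nat -> nat) :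
  (T < #|G|)%N -> (forall h : 'I_M, G h -> (f h < T)%N) ->
  exists h h' : 'I_M, [/\ G h, G h', (h < h')%N & f h = f h'].
Proof.
move=> TG fT; apply: contrapT => noh.
have T0 : (0 < T)%N.
  case: T TG fT => // TG fT.
  by have /card_gt0P [h /fT] := TG.
(* The default value is met only outside [G], where nothing is compared. *)
pose f' (h : 'I_M) : 'I_T := odflt (Ordinal T0) (insub (f h)).
have f'E h : G h -> f' h = f h :> nat.
  by move=> Gh; rewrite /f' insubT ?fT.
have inj : {in G &, injective f'}.
  move=> h h' Gh Gh' /(congr1 val)/=; rewrite !f'E// => E.
  apply: contrapT => /eqP; rewrite -val_eqE/= neq_ltn => /orP[] lt.
    by apply: noh; exists h, h'.
  by apply: noh; exists h', h.
by move: TG; rewrite -(card_in_image inj) ltnNge -[X in (_ <= X)%N]card_ord max_card.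
Qed.

(** Lets several quantities be coded as one number, so that a single use of the pigeonhole principle
    makes them all agree. *)
Lemma mixed_radix_lt (a b x y : nat) : (x < a)%N -> (y < b)%N -> (x * b + y < a * b)%N.
Proof.
move=> xa yb; apply: (@leq_trans (x.+1 * b)); last by rewrite leq_mul2r xa orbT.
by rewrite mulSn addnC ltn_add2r.
Qed.

Lemma ltn_sub_same_divn (d a b : nat) : (0 < d)%N -> (a %/ d = b %/ d)%N -> (b - a < d)%N.
Proof.
move=> d0 E; rewrite (divn_eq a d) (divn_eq b d) E subnDl.
by apply: leq_ltn_trans (leq_subr _ _) (ltn_pmod _ _).
Qed.

(** The distance to the nearest integer is at most [e], with the integer exposed as a witness. *)
Definition near_int {R : realType} (x e : R) := exists a : int, `|x - a%:~R| <= e.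

Lemma near_int_le {R : realType} (x e e' : R) : e <= e' -> near_int x e -> near_int x e'.
Proof. by move=> ee' [a ha]; exists a; apply: le_trans ee'. Qed.

Lemma near_int_ge1 {R : realType} (x e : R) : 1 <= e -> near_int x e.
Proof. by move=> e1; have [a ha] := exists_near_int x; exists a; lra. Qed.

Lemma near_intMn {R : realType} (x e : R) (n : nat) :
  near_int x e -> near_int (n%:R * x) (n%:R * e).
Proof.
move=> [a ha]; exists (n%:Z * a); rewrite intrM -mulrBr normrM normr_nat.
exact: ler_wpM2l.
Qed.

Lemma near_intB {R : realType} (x y e f : R) :
  near_int x e -> near_int y f -> near_int (x - y) (e + f).
Proof.
move=> [a ha] [b hb]; exists (a - b); rewrite intrB.
have -> : x - y - (a%:~R - b%:~R) = (x - a%:~R) - (y - b%:~R) by ring.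
by apply: le_trans (ler_normB _ _) _; apply: lerD.
Qed.

(* Two close elements of [G] give an [r] with [r beta] nearly an integer up to an error [gamma];
   two elements of [G] far apart, congruent modulo [r], whose distance is still too small
   for the multiples of [gamma] to wrap around, then show that [gamma] is much smaller. *)
Lemma Vinogradov (R : realType) (E C j : nat) : (0 < E)%N -> (0 < j)%N ->
  exists L C' : nat, (0 < L)%N /\
    forall (M : nat) (beta : R) (G : pred 'I_M), (0 < M)%N -> (M <= E * #|G|)%N ->
    (forall h : 'I_M, G h -> near_int (h%:R * beta) (C%:R / M%:R ^+ j)) ->
    near_int (L%:R * beta) (C'%:R / M%:R ^+ j.+1).
Proof.
move=> E0 j0.
(* [L] is a multiple of every gap up to [B]. The second gap will be less than [M %/ nb + 1], too
   short for wrapping around, and at least [M %/ T], which gains a factor of order [M]. Up to [M1]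
   the constant [C'] makes the claim trivial. *)
pose B := (2 * E)%N; pose L := B`!; pose nb := (8 * L * C).+1.
pose T := (2 * E * nb * L)%N; pose M1 := (8 * L * C + T + 2 * E).+1.
have L0 : (0 < L)%N by exact: fact_gt0.
exists L, (M1 ^ j.+1 + 4 * T * L * C)%N; split => // M beta G M0 MG HG.
have MR : 0 < M%:R :> R by rewrite ltr0n.
have [MM1|M1M] := leqP M M1.
  apply: near_int_ge1; rewrite ler_pdivlMr ?exprn_gt0// mul1r -natrX ler_nat.
  by apply: leq_trans (leq_addr _ _); rewrite leq_exp2r.
set eta : R := C%:R / M%:R ^+ j in HG *.
have etaM : eta <= C%:R / M%:R.
  rewrite /eta ler_pdivrMr ?exprn_gt0// -[j]prednK// exprS mulrA divfK ?lt0r_neq0//.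
  by rewrite ler_peMr// -natrX ler1n expn_gt0 M0.
have eta0 : 0 <= eta by rewrite divr_ge0// exprn_ge0.
(* Cut into blocks of length [B]: there are fewer blocks than elements of [G], so two of these are
   at distance at most [B], a divisor of [L]. *)
have [a ha] : near_int (L%:R * beta) (L%:R * (2 * eta)).
  have [||h [h' [Gh Gh' lt E1]]] := @pigeonhole_lt M (M %/ B).+1 G (fun h => h %/ B)%N.
  - rewrite -(ltn_pmul2l E0); apply: leq_trans MG.
    have := leq_trunc_div M B; rewrite {2}/B; move: M1M; rewrite /M1; nia.
  - by move=> h _; rewrite ltnS leq_div2r// ltnW.
  have rB : (h' - h <= B)%N.
    by rewrite ltnW// ltn_sub_same_divn// muln_gt0.
  have /dvdnP[s Ls] : (h' - h %| L)%N by apply: dvdn_fact; rewrite rB subn_gt0 lt.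
  rewrite Ls natrM -!mulrA; apply: near_intMn.
  have [a ha] := near_intB _ _ _ _ (HG _ Gh') (HG _ Gh).
  exists a; rewrite natrB 1?ltnW// mulrBl; apply: le_trans ha _.
  have : 1 <= (h'%:R - h%:R) :> R by rewrite -natrB 1?ltnW// ler1n subn_gt0.
  nra.
set gamma := L%:R * beta - a%:~R in ha.
exists a; rewrite -/gamma.
pose s := (M %/ T)%N.
have T0 : (0 < T)%N by rewrite !muln_gt0 E0 L0.
have TM : (T < M)%N by apply: ltn_trans M1M; rewrite /M1; lia.
have M1M' : (8 * L * C + 1 <= M)%N by apply: leq_trans (ltnW M1M); rewrite /M1; lia.
have s0 : (0 < s)%N by rewrite divn_gt0// ltnW.
have Ms : (M < 2 * T * s)%N.
  by have := divn_eq M T; have := ltn_pmod M T0; rewrite -/s; nia.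
pose B2 := (M %/ nb).+1.
(* Boxes record the block of length [B2] and the residues modulo [L] and modulo [s]. Two elements in
   one box differ by a multiple [t * L] that is at least [s] and less than [B2]. *)
have [||h [h' [Gh Gh' lt E1]]] :=
    @pigeonhole_lt M (nb * L * s) G (fun h => (h %/ B2 * L + h %% L) * s + h %% s)%N.
- have := leq_trunc_div M T; rewrite -/s {1}/T; nia.
- move=> h _.
  have hb : (h %/ B2 < nb)%N.
    rewrite ltn_divLR//; apply: ltn_trans (ltn_ord h) _.
    by rewrite mulnC ltn_ceil.
  by apply: mixed_radix_lt; rewrite ?ltn_pmod//; apply: mixed_radix_lt; rewrite ?ltn_pmod.
have [E2 Es] : (h %/ B2 * L + h %% L)%N = (h' %/ B2 * L + h' %% L)%N /\ (h %% s)%N = (h' %% s)%N.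
  split; [move/(congr1 (divn^~ s)): E1|move/(congr1 (modn^~ s)): E1].
    by rewrite /= !divnMDl// !(@divn_small (_ %% s)) ?ltn_pmod// !addn0.
  by rewrite /= !modnMDl !modn_mod.
have [EB EL] : (h %/ B2)%N = (h' %/ B2)%N /\ (h %% L)%N = (h' %% L)%N.
  split; [move/(congr1 (divn^~ L)): E2|move/(congr1 (modn^~ L)): E2].
    by rewrite /= !divnMDl// !(@divn_small (_ %% L)) ?ltn_pmod// !addn0.
  by rewrite /= !modnMDl !modn_mod.
have hB2 : (h' - h < B2)%N.
  exact: ltn_sub_same_divn.
have hs : (s <= h' - h)%N.
  apply: dvdn_leq; first by rewrite subn_gt0.
  by rewrite -eqn_mod_dvd 1?ltnW// Es.
have /dvdnP[t Lt] : (L %| h' - h)%N by rewrite -eqn_mod_dvd 1?ltnW// EL.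
have t0 : (0 < t)%N by case: t Lt (lt) => //; rewrite mul0n -subn_gt0 => ->.
have [b hb] := near_intB _ _ _ _ (HG _ Gh') (HG _ Gh).
have tg : t%:R * gamma = (h'%:R * beta - h%:R * beta) - (t%:Z * a)%:~R.
  by rewrite /gamma intrM -mulrBl -natrB 1?ltnW// Lt natrM; ring.
have LtR : t%:R * L%:R < B2%:R :> R by rewrite -natrM ltr_nat -Lt.
have sR : s%:R <= t%:R * L%:R :> R by rewrite -natrM ler_nat -Lt.
have MsR : M%:R <= 2 * T%:R * s%:R :> R by rewrite -!natrM ler_nat ltnW.
have LR : 1 <= L%:R :> R by rewrite ler1n.
have tR : 1 <= t%:R :> R by rewrite ler1n.
have M1R : 8 * L%:R * C%:R + 1 <= M%:R :> R.
  by rewrite -!natrM natr1 ler_nat -addn1.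
have CM : eta <= 1 / 8.
  apply: le_trans etaM _; rewrite ler_pdivrMr//.
  have : 0 <= C%:R :> R by []. nra.
have tgs : t%:R * `|gamma| < 1 / 2.
  have : B2%:R <= M%:R / nb%:R + 1 :> R.
    by rewrite /B2 -natr1 lerD2r ler_pdivlMr// -natrM ler_nat leq_trunc_div.
  have : t%:R * `|gamma| <= t%:R * (L%:R * (2 * eta)) by apply: ler_wpM2l.
  have : M%:R * eta <= C%:R by rewrite mulrC -ler_pdivlMr.
  have : 8 * L%:R * C%:R * (M%:R / nb%:R) + M%:R / nb%:R = M%:R :> R.
    rewrite -{2}[M%:R / _]mul1r -mulrDl -!natrM natr1 mulrC divfK//.
    by rewrite pnatr_eq0.
  have : 0 <= M%:R / nb%:R :> R by rewrite divr_ge0.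
  move: (M%:R / nb%:R) => y y0 Hy He Htg HB2.
  have C0 : 0 <= C%:R :> R by [].
  have CL : C%:R * y <= L%:R * C%:R * y by rewrite -mulrA ler_peMl// mulr_ge0.
  have CL' : C%:R <= L%:R * C%:R :> R by rewrite ler_peMl.
  have y1 : t%:R * L%:R * (2 * eta) <= (y + 1) * (2 * eta) by apply: ler_wpM2r; lra.
  have y2 : (M%:R * eta) * (2 * (y + 1)) <= C%:R * (2 * (y + 1)) by apply: ler_wpM2r; lra.
  have : M%:R * ((y + 1) * (2 * eta)) < M%:R * (1 / 2) by lra.
  rewrite ltr_pM2l//; lra.
(* Both [t * gamma] and its distance to the integer [b - t * a] are small, so this integer is 0.
   Hence $t|\gamma|\le 2\eta$, and dividing by $t\ge s/L$ gives the gain. *)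
have b0 : b = t%:Z * a.
  apply/eqP; rewrite -subr_eq0 -normr_le0 -ltzD1 add0r -(ltr_int R).
  rewrite intr_norm intrB.
  have -> : b%:~R - (t%:Z * a)%:~R = t%:R * gamma - ((h'%:R * beta - h%:R * beta) - b%:~R).
    by rewrite tg; ring.
  apply: le_lt_trans (ler_normB _ _) _.
  rewrite normrM normr_nat mulr1z; lra.
move: hb; rewrite b0 -tg normrM normr_nat => hb.
rewrite ler_pdivlMr ?exprn_gt0//.
have etaE : eta * M%:R ^+ j = C%:R by rewrite /eta divfK// lt0r_neq0// exprn_gt0.
have Mj := exprn_gt0 j MR; rewrite exprS natrD.
apply: (@le_trans _ _ (4 * T * L * C)%:R); last by rewrite lerDr.
rewrite (natrM _ (4 * T * L)) (natrM _ (4 * T)) (natrM _ 4) -etaE.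
apply: (@le_trans _ _ (2 * T%:R * L%:R * (t%:R * `|gamma|) * M%:R ^+ j)).
  rewrite [leLHS]mulrA; apply: ler_wpM2r; first exact: ltW.
  rewrite [leLHS]mulrC [leRHS](_ : _ = 2 * T%:R * (t%:R * L%:R) * `|gamma|); last by ring.
  apply: ler_wpM2r => //; apply: le_trans MsR _; exact: ler_wpM2l.
rewrite [leRHS](_ : _ = 2 * T%:R * L%:R * (2 * eta) * M%:R ^+ j); last by ring.
apply: ler_wpM2r; first exact: ltW.
apply: ler_wpM2l => //; lra.
Qed.

(* An inductive substitute for "polynomial of degree at most [k] whose coefficient of
   degree [k] is [g / k!]", in the form in which differencing uses it. *)
Fixpoint phase {R : realType} (k : nat) (g : R) (f : nat -> R) : Prop :=
  if k is k'.+1 then forall h, phase k' (h%:R * g) (fun m => f (m + h)%N - f m)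
  else forall m, f m = g.

Lemma phase1 {R : realType} (g : R) (f : nat -> R) :
  phase 1 g f -> forall m, f m = g * m%:R + f 0%N.
Proof. by move=> fg m; have := fg m 0%N; rewrite add0n mulrC => <-; rewrite subrK. Qed.

(** Induction on the degree. By van der Corput, a large sum makes the differenced sums large for
    many shifts [h]; by induction a fixed multiple of [h * g] is then nearly an integer for all
    these [h], and [Vinogradov] removes the factor [h]. *)
Lemma Weyl {R : realType} (k E : nat) : (0 < E)%N ->
  exists L C : nat, (0 < L)%N /\
    forall (M : nat) (f : nat -> R) (g : R), (0 < M)%N -> phase k.+1 g f ->
    M%:R <= E%:R * `|\sum_(m < M) ecos (f m)| ->
    near_int (L%:R * g) (C%:R / M%:R ^+ k.+1).
Proof.
elim: k E => [|k IH] E E0.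
  exists 1%N, E; split => // M f g M0 /phase1 fE ME; rewrite mul1r expr1.
  have [a _ /(_ (f 0%N) M)] := sum_ecos_linear_le g.
  under eq_bigr do rewrite -fE.
  move=> H; exists a; rewrite ler_pdivlMr ?ltr0n//.
  apply: le_trans (ler_wpM2l (normr_ge0 _) ME) _.
  by rewrite mulrCA ler_piMr.
(* One factor 2 comes from van der Corput; the other leaves half of the total to the shifts in [G],
   those outside contributing at most [M] each. *)
pose E' := (4 * E ^ 2)%N.
have E'0 : (0 < E')%N by rewrite muln_gt0 expn_gt0 E0.
have [L1 [C1 [L10 H1]]] := IH E' E'0.
have [L2 [C2 [L20 H2]]] := @Vinogradov R E' (C1 * E' ^ k.+1) k.+1 E'0 isT.
exists (L2 * L1)%N, C2; split; first by rewrite muln_gt0 L20.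
move=> M f g M0 fg ME; rewrite natrM -mulrA.
have MR : 0 < M%:R :> R by rewrite ltr0n.
pose s (h : nat) : R := `|\sum_(m < M - h) ecos (f (m + h)%N - f m)|.
have sle (h : nat) : s h <= (M - h)%:R.
  apply: le_trans (ler_norm_sum _ _ _) _.
  apply: (@le_trans _ _ (\sum_(m < M - h) 1)).
    by apply: ler_sum => m _; exact: ecos_le1.
  by rewrite sumr_const card_ord.
pose G : pred 'I_M := fun h => M%:R <= E'%:R * s h.
apply: (H2 M _ G) => //; last first.
  (* A shift in [G] leaves at least [M / E'] terms, so passing from [M - h] to [M] in the error
     costs only the factor [E' ^ k.+1]. *)
  move=> h Gh.
  have MhR : 0 < (M - h)%:R :> R by rewrite ltr0n subn_gt0.
  have MhE : M%:R <= E'%:R * (M - h)%:R :> R.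
    by apply: le_trans Gh _; apply: ler_wpM2l.
  have Mh : (M - h)%:R <= M%:R :> R by rewrite ler_nat leq_subr.
  have [||a ha] := H1 (M - h)%N (fun m => f (m + h)%N - f m) (h%:R * g) _ (fg h).
  - by rewrite subn_gt0.
  - exact: le_trans Mh Gh.
  exists a; rewrite mulrCA; apply: le_trans ha _.
  rewrite ler_pdivrMr ?exprn_gt0// mulrAC ler_pdivlMr ?exprn_gt0//.
  rewrite natrM natrX -mulrA -exprMn; apply: ler_wpM2l => //.
  by rewrite lerXn2r ?nnegrE// mulr_ge0.
rewrite -(ler_nat R) -(ler_pM2r MR).
have ER : 1 <= E%:R :> R by rewrite ler1n.
have vdC := van_der_Corput f M.
have S2 : M%:R ^+ 2 <= E%:R ^+ 2 * (\sum_(m < M) ecos (f m)) ^+ 2.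
  rewrite -exprMn -[leRHS]real_normK ?num_real// normrM normr_nat.
  by rewrite lerXn2r ?nnegrE// mulr_ge0.
have sG : E'%:R * \sum_(h < M) s h <= (E' * #|G|)%:R * M%:R + M%:R ^+ 2.
  apply: (@le_trans _ _ (\sum_(h < M) ((E'%:R * M%:R) *+ G h + M%:R))).
    rewrite mulr_sumr; apply: ler_sum => h _.
    have [Gh|] := boolP (G h); rewrite ?mulr1n ?mulr0n.
      rewrite -[leLHS]addr0; apply: lerD => //; apply: ler_wpM2l => //.
      by apply: le_trans (sle h) _; rewrite ler_nat leq_subr.
    by rewrite add0r /G -ltNge => /ltW.
  rewrite big_split/= sumr_const card_ord -[M%:R *+ M]mulr_natr -expr2 lerD2r.
  rewrite sumrMnr (_ : (\sum_h G h)%N = #|G|); last first.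
    by rewrite -sum1_card [RHS]big_mkcond; apply: eq_bigr => h _; rewrite unfold_in.
  by rewrite -[leLHS]mulr_natr natrM mulrAC.
move: sG; rewrite {1}/E' natrM natrX.
have := vdC; rewrite -/(\sum_(h < M) s h).
set W := \sum_(h < M) _; set S := \sum_(h < M) _ => W2 sG.
have : E%:R ^+ 2 * W ^+ 2 <= E%:R ^+ 2 * (2 * S) by apply: ler_wpM2l => //; rewrite exprn_ge0.
move: S2 sG; rewrite -/W -expr2; lra.
Qed.

Lemma phaseD {R : realType} k (g g' : R) f f' : phase k g f -> phase k g' f' ->
  phase k (g + g') (fun m => f m + f' m).
Proof.
elim: k g g' f f' => [|k IH] g g' f f' /=; first by move=> + + m => -> ->.
move=> H H' h; rewrite mulrDr.
have := IH _ _ _ _ (H h) (H' h); congr phase; apply/funext => m /=; ring.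
Qed.

Lemma phaseZ {R : realType} k a (g : R) f : phase k g f -> phase k (a * g) (fun m => a * f m).
Proof.
elim: k g f => [|k IH] g f /=; first by move=> + m => ->.
move=> H h; rewrite mulrCA.
by have := IH _ _ (H h); congr phase; apply/funext => m /=; ring.
Qed.

Lemma phase_shift {R : realType} k (g : R) f s : phase k g f -> phase k g (fun m => f (m + s)%N).
Proof.
elim: k g f => [|k IH] g f /= H; first by move=> m; exact: H.
by move=> h; have := IH _ _ (H h); congr phase; apply/funext => m /=; rewrite addnAC.
Qed.

Lemma phaseS {R : realType} k (g : R) f : phase k g f -> phase k.+1 0 f.
Proof.
elim: k g f => [|k IH] g f H.
  by move=> h m; rewrite !H subrr mulr0.
by move=> h; rewrite mulr0; apply: IH (H h).
Qed.

Lemma phase_cst {R : realType} k (a : R) : phase k.+1 0 (fun=> a).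
Proof.
by elim: k => [|k IH]; [apply: (@phaseS R 0 a)|apply: phaseS IH].
Qed.

(** Product rule: $(m+h)f(m+h)-mf(m)=m(f(m+h)-f(m))+hf(m+h)$. *)
Lemma phaseM {R : realType} k (g : R) f : phase k g f ->
  phase k.+1 (k.+1%:R * g) (fun m => m%:R * f m).
Proof.
elim: k g f => [|k IH] g f H h.
  by move=> m; rewrite !H natrD; ring.
have := phaseD _ _ _ _ _ (IH _ _ (H h)) (phaseZ _ h%:R _ _ (phase_shift _ _ _ h H)).
congr phase; first by rewrite -(natr1 k.+1); ring.
by apply/funext => m /=; rewrite natrD; ring.
Qed.

Lemma phaseX {R : realType} k : phase k (k`!%:R : R) (fun m => m%:R ^+ k).
Proof.
elim: k => [|k IH]; first by move=> m; rewrite expr0.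
have := phaseM _ _ _ IH; rewrite -natrM -factS.
by congr phase; apply/funext => m; rewrite exprS.
Qed.

(** * Polynomials with natural coefficients and no constant term *)

Definition qpoly (n : nat) (c : nat -> nat) (m : nat) : nat :=
  (\sum_(j < n.+1) c j * m ^ j.+1)%N.

Lemma phase_qpoly {R : realType} n c (alpha phi : R) :
  phase n.+1 ((n.+1)`!%:R * (c n)%:R * alpha) (fun m => alpha * (qpoly n c m)%:R + phi).
Proof.
have cX j : phase j.+1 (alpha * ((c j)%:R * (j.+1)`!%:R)) (fun m => alpha * ((c j)%:R * m%:R ^+ j.+1)).
  exact/phaseZ/phaseZ/phaseX.
rewrite -[X in phase _ X]addr0; apply: phaseD; last exact: phase_cst.
elim: n => [|n IH].
  have := cX 0%N; congr phase; first by ring.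
  by apply/funext => m; rewrite /qpoly big_ord1 natrM natrX.
have := phaseD _ _ _ _ _ (phaseS _ _ _ IH) (cX n.+1); congr phase; first by ring.
by apply/funext => m; rewrite /qpoly [in RHS]big_ord_recr/= natrD natrM natrX mulrDr.
Qed.

Lemma leq_qpoly n c : {homo qpoly n c : m m' / (m <= m')%N}.
Proof. by move=> m m' mm'; apply: leq_sum => j _; rewrite leq_mul2l leq_exp2r// mm' orbT. Qed.

Lemma qpoly_le n c M : (0 < M)%N -> (qpoly n c M <= qpoly n c 1 * M ^ n.+1)%N.
Proof.
move=> M0; rewrite big_distrl/=; apply: leq_sum => j _.
by rewrite exp1n muln1 leq_mul2l leq_pexp2l ?orbT.
Qed.

(** * Exponential sums along a polynomial *)

(** As [q] permutes the residues modulo [D], this is a rearranged complete linear sum. *)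
Lemma sum_ecos_block {R : realType} (q : nat -> nat) (D N : nat) (a : int) (phi : R) :
  (0 < D)%N -> ~~ (D%:Z %| a)%Z ->
  (forall m m', q m = q m' %[mod D] -> m = m' %[mod D]) ->
  \sum_(i < D) ecos (a%:~R / D%:R * (q (N + i)%N)%:R + phi) = 0.
Proof.
move=> D0 Da qinj.
pose s (i : 'I_D) := Ordinal (ltn_pmod (q (N + i)%N) D0).
have sinj : injective s.
  move=> i j /(congr1 val)/= /qinj /eqP; rewrite eqn_modDl => /eqP.
  by rewrite !modn_small// => /val_inj.
rewrite -[RHS](sum_ecos_full_period _ _ phi D0 Da) [RHS](reindex_inj sinj)/=.
apply: eq_bigr => i _.
rewrite [in LHS](divn_eq (q (N + i)%N) D) natrD natrM.
rewrite -[RHS](ecosDz _ (a * (q (N + i) %/ D)%N%:Z)) intrM; congr ecos.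
rewrite mulrDr mulrCA mulfVK ?pnatr_eq0 -?lt0n//.
rewrite -pmulrn; ring.
Qed.

(** Cut into blocks of length [D]. Freezing $\beta q$ at the start of a block makes its sum vanish;
    the errors of freezing telescope to $q(M)$, and the last incomplete block costs at most [D]. *)
Lemma sum_ecos_nontrivial_arc {R : realType} (q : nat -> nat) (D M : nat) (a : int)
    (beta phi : R) :
  (0 < D)%N -> ~~ (D%:Z %| a)%Z ->
  (forall m m', q m = q m' %[mod D] -> m = m' %[mod D]) ->
  {homo q : m m' / (m <= m')%N} ->
  `|\sum_(m < M) ecos ((a%:~R / D%:R + beta) * (q m)%:R + phi)| <=
  8 * `|beta| * D%:R * (q M)%:R + D%:R.
Proof.
move=> D0 Da qinj qmono.
pose F m := ecos ((a%:~R / D%:R + beta) * (q m)%:R + phi).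
have blocks n : `|\sum_(m < D * n) F m| <= 8 * `|beta| * D%:R * (q (D * n)%N)%:R.
  elim: n => [|n IH]; first by rewrite muln0 big_ord0 normr0 !mulr_ge0.
  rewrite mulnS addnC big_split_ord/=.
  apply: le_trans (ler_normD _ _) _.
  set N := (D * n)%N in IH *.
  pose G (i : 'I_D) := ecos (a%:~R / D%:R * (q (N + i)%N)%:R + (beta * (q N)%:R + phi)).
  have FG (i : 'I_D) : `|F (N + i)%N - G i| <= 8 * `|beta| * ((q (N + D))%:R - (q N)%:R).
    apply: le_trans (dist_ecos_le _ _) _.
    rewrite [X in `|X|](_ : _ = beta * ((q (N + i))%:R - (q N)%:R)); last by ring.
    rewrite normrM mulrA; apply: ler_wpM2l; first by rewrite mulr_ge0.
    rewrite ger0_norm ?subr_ge0 ?ler_nat ?qmono ?leq_addr//.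
    by rewrite lerD2r ler_nat qmono// leq_add2l ltnW.
  have -> : \sum_(i < D) F (N + i)%N = \sum_(i < D) (F (N + i)%N - G i).
    by rewrite sumrB sum_ecos_block// subr0.
  have : `|\sum_(i < D) (F (N + i)%N - G i)| <= D%:R * (8 * `|beta| * ((q (N + D))%:R - (q N)%:R)).
    apply: le_trans (ler_norm_sum _ _ _) _.
    apply: le_trans (ler_sum _ (fun i _ => FG i)) _.
    by rewrite sumr_const card_ord -[leLHS]mulr_natl.
  move: IH; lra.
rewrite (divn_eq M D) mulnC big_split_ord/=.
apply: le_trans (ler_normD _ _) _; apply: lerD.
  apply: le_trans (blocks _) _; apply: ler_wpM2l; first by rewrite !mulr_ge0.
  by rewrite ler_nat qmono// leq_addr.
apply: le_trans (ler_norm_sum _ _ _) _.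
apply: (@le_trans _ _ (\sum_(i < M %% D) 1)); first by apply: ler_sum => i _; exact: ecos_le1.
by rewrite sumr_const card_ord ler_nat ltnW// ltn_pmod.
Qed.

(** By Weyl's inequality a large sum puts $D\alpha$ close to an integer [a]. If [D] divides [a],
    then $\alpha$ itself is close to an integer; otherwise the sum is bounded. [L] is fixed before
    [c], whose coefficients will be built from it. *)
Lemma qpoly_equidistribution {R : realType} (n E : nat) : (0 < E)%N ->
  exists L : nat, (0 < L)%N /\ forall c : nat -> nat, (0 < c n)%N ->
    (forall m m', qpoly n c m = qpoly n c m' %[mod L * (n.+1)`! * c n] ->
       m = m' %[mod L * (n.+1)`! * c n]) ->
    exists C M0 : nat, forall (M : nat) (alpha : R), (M0 < M)%N ->
      near_int alpha (C%:R / M%:R ^+ n.+1) \/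
      forall phi M', (M' <= M)%N ->
        E%:R * `|\sum_(m < M') ecos (alpha * (qpoly n c m)%:R + phi)| <= M%:R.
Proof.
move=> E0; have [L [C1 [L0 HW]]] := @Weyl R n E E0; exists L; split => // c c0.
set D := (L * _ * c n)%N; set q := qpoly n c => qinj.
(* A large sum has at least [M / E] terms, whence the power of [E]; [K] bounds the sums near the
   nonintegral fractions $a/D$. *)
pose C := (C1 * E ^ n.+1)%N; pose K := (8 * C * q 1 + D)%N.
have D0 : (0 < D)%N by rewrite !muln_gt0 L0 fact_gt0.
exists C, (E * K)%N => M alpha MM0.
have M0 : (0 < M)%N by exact: leq_ltn_trans MM0.
have MR : 0 < M%:R :> R by rewrite ltr0n.
apply: contrapT => /not_orP[far].
apply; move=> phi M' M'M; rewrite leNgt; apply/negP => big; apply: far.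
set S := `|_| in big.
have S_le : S <= M'%:R.
  apply: le_trans (ler_norm_sum _ _ _) _.
  apply: (@le_trans _ _ (\sum_(i < M') 1)); first by apply: ler_sum => i _; exact: ecos_le1.
  by rewrite sumr_const card_ord.
have MM' : M%:R <= E%:R * M'%:R :> R.
  by apply: le_trans (ltW big) _; apply: ler_wpM2l.
have M'0 : (0 < M')%N by move: MM'; rewrite -natrM ler_nat; case: M' {M'M big S S_le} => //; lia.
have M'R : 0 < M'%:R :> R by rewrite ltr0n.
have [|a] := HW M' _ _ M'0 (@phase_qpoly R n c alpha phi).
  by apply: le_trans (ltW big); rewrite ler_nat.
rewrite !mulrA -!natrM -/D => ha.
have {}ha : `|D%:R * alpha - a%:~R| <= C%:R / M%:R ^+ n.+1.
  apply: le_trans ha _.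
  rewrite ler_pdivrMr ?exprn_gt0// mulrAC ler_pdivlMr ?exprn_gt0//.
  rewrite natrM natrX -mulrA -exprMn; apply: ler_wpM2l => //.
  by rewrite lerXn2r ?nnegrE// mulr_ge0.
have DR : 1 <= D%:R :> R by rewrite ler1n.
have DR0 : D%:R != 0 :> R by rewrite pnatr_eq0 -lt0n.
pose beta := alpha - a%:~R / D%:R.
have betaE : D%:R * beta = D%:R * alpha - a%:~R by rewrite /beta mulrBr mulrCA divff// mulr1.
have [/dvdzP[b ab]|Da] := boolP (D%:Z %| a)%Z.
  exists b; have -> : alpha - b%:~R = beta by rewrite /beta ab intrM mulfK.
  apply: le_trans ha; rewrite -betaE normrM normr_nat ler_peMl//.
exfalso.
have := sum_ecos_nontrivial_arc q D M' a beta phi D0 Da qinj (leq_qpoly n c).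
have -> : a%:~R / D%:R + beta = alpha by rewrite /beta addrC subrK.
rewrite -/S => Sle.
have : 8 * `|beta| * D%:R * (q M')%:R + D%:R <= K%:R.
  have Db : D%:R * `|beta| <= C%:R / M%:R ^+ n.+1 by rewrite -betaE normrM normr_nat in ha.
  have qM' : (q M')%:R <= (q 1%N)%:R * M%:R ^+ n.+1 :> R.
    by rewrite -natrX -natrM ler_nat (leq_trans (leq_qpoly n c _ _ M'M))// qpoly_le.
  have Mn : M%:R ^+ n.+1 != 0 :> R by rewrite lt0r_neq0// exprn_gt0.
  rewrite natrD lerD2r (natrM _ (8 * C)) (natrM _ 8).
  rewrite [leLHS](_ : _ = 8 * (D%:R * `|beta| * (q M')%:R)); last by ring.
  rewrite -[leRHS]mulrA ler_pM2l//.
  have -> : C%:R * (q 1%N)%:R = C%:R / M%:R ^+ n.+1 * ((q 1%N)%:R * M%:R ^+ n.+1) :> R.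
    by rewrite [RHS]mulrACA mulVf// mulr1.
  by apply: ler_pM => //; rewrite mulr_ge0.
move=> /(le_trans Sle) SK; move: big; rewrite ltNge => /negP; apply.
apply: (@le_trans _ _ (E * K)%:R); last by rewrite ler_nat ltnW.
by rewrite natrM; apply: ler_wpM2l.
Qed.

(** * Growth of the steps of a polynomial *)

Lemma expn_stepS j x :
  (x.+1 ^ j.+1 - x ^ j.+1 = x.+1 * (x.+1 ^ j - x ^ j) + x ^ j)%N.
Proof.
have le : (x ^ j <= x.+1 ^ j)%N by case: j => // j; rewrite leq_exp2r.
rewrite !expnS; move: (x.+1 ^ j)%N (x ^ j)%N le => a b le.
rewrite -{1}(subnKC le); move: (a - b)%N => d; rewrite mulnDr; lia.
Qed.

Lemma leq_expn_step j : {homo (fun m => m.+1 ^ j - m ^ j)%N : m m' / (m <= m')%N}.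
Proof.
apply: homo_leq => [//|? ? ?|m]; first exact: leq_trans.
elim: j => [|j IH] //.
rewrite !expn_stepS leq_add ?leq_mul//.
by case: j {IH} => // j; rewrite leq_exp2r.
Qed.

(** Discrete and cruder form of $xf'(x)\le jf(x)$ for $f(x)=x^j$; the 3 comes from $(m+1)+m\le
    3m$. *)
Lemma leq_mul_expn_step j m : (0 < m)%N -> (m * (m.+1 ^ j - m ^ j) <= 3 ^ j * m ^ j)%N.
Proof.
move=> m0; rewrite -expnMn; elim: j => [|j IH]; first by rewrite muln0.
rewrite expn_stepS expnS.
have : (m ^ j <= (3 * m) ^ j)%N by case: j {IH} => // j; rewrite leq_exp2r// leq_pmull.
move: IH; move: (m.+1 ^ j - m ^ j)%N (m ^ j)%N ((3 * m) ^ j)%N => d b e de be.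
rewrite mulnDr mulnCA; apply: (@leq_trans (m.+1 * e + m * e)).
  by rewrite leq_add// leq_mul2l ?de ?be orbT.
by rewrite -mulnDl leq_mul2r; apply/orP; right; lia.
Qed.

(** The weight of the value $q(m)$: it stands for the whole interval up to $q(m+1)$, which makes up
    for the thinning out of the values. *)
Definition qstep (n : nat) (c : nat -> nat) (m : nat) : nat :=
  (qpoly n c m.+1 - qpoly n c m)%N.

Lemma qstepE n c m : qstep n c m = (\sum_(j < n.+1) c j * (m.+1 ^ j.+1 - m ^ j.+1))%N.
Proof.
rewrite /qstep /qpoly -sumnB => [|j _]; last by rewrite leq_mul2l leq_exp2r// leqnSn orbT.
by apply: eq_bigr => j _; rewrite mulnBr.
Qed.

Lemma leq_qstep n c : {homo qstep n c : m m' / (m <= m')%N}.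
Proof.
move=> m m' mm'; rewrite !qstepE; apply: leq_sum => j _.
by rewrite leq_mul2l (leq_expn_step j.+1 _ _ mm') orbT.
Qed.

Lemma qpolyS n c m : qpoly n c m.+1 = (qpoly n c m + qstep n c m)%N.
Proof. by rewrite subnKC// leq_qpoly. Qed.

Lemma qpoly0 n c : qpoly n c 0 = 0%N.
Proof. by rewrite /qpoly big1// => j _; rewrite exp0n// muln0. Qed.

Lemma leq_mul_qstep n c m : (m * qstep n c m <= 3 ^ n.+1 * qpoly n c m)%N.
Proof.
have [->|m0] := posnP m; first by rewrite mul0n.
rewrite qstepE !big_distrr/=; apply: leq_sum => j _.
rewrite mulnCA [leqRHS]mulnCA leq_mul2l; apply/orP; right.
apply: leq_trans (leq_mul_expn_step _ _ m0) _.
by rewrite leq_mul2r leq_pexp2l ?orbT.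
Qed.

Lemma leq_expn_qpoly n c m : (0 < c n)%N -> (m ^ n.+1 <= qpoly n c m)%N.
Proof.
move=> c0; rewrite /qpoly big_ord_recr/=; apply: leq_trans (leq_addl _ _).
by rewrite leq_pmull.
Qed.

(** * Weighted polynomial values compared with an interval *)

(** Summation by parts; the variation of the increasing weight is [w M - w 0]. *)
Lemma Abel_sum_le {R : realType} (w a : nat -> R) (B : R) (M : nat) :
  0 <= w 0%N -> {homo w : m m' / (m <= m')%N >-> m <= m'} ->
  (forall M', (M' <= M)%N -> `|\sum_(m < M') a m| <= B) ->
  `|\sum_(m < M) w m * a m| <= 2 * w M * B.
Proof.
move=> w0 wmono aB.
pose S k := \sum_(m < k) a m.
have -> : \sum_(m < M) w m * a m = w M * S M - \sum_(m < M) (w m.+1 - w m) * S m.+1.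
  elim: M {aB} => [|M IH]; first by rewrite /S !big_ord0; ring.
  by rewrite !big_ord_recr/= IH /S big_ord_recr/=; ring.
have B0 : 0 <= B by apply: le_trans (aB 0%N _); rewrite ?normr_ge0.
have w0M : w 0%N <= w M by exact: wmono.
have : `|\sum_(m < M) (w m.+1 - w m) * S m.+1| <= (w M - w 0%N) * B.
  elim: M aB {w0M} => [|M IH] aB; first by rewrite big_ord0 normr0 subrr mul0r.
  rewrite big_ord_recr/=; apply: le_trans (ler_normD _ _) _.
  have -> : (w M.+1 - w 0%N) * B = (w M - w 0%N) * B + (w M.+1 - w M) * B by ring.
  apply: lerD; first by apply: IH => M' M'M; apply: aB; rewrite ltnW.
  rewrite normrM ger0_norm ?subr_ge0 ?wmono//; apply: ler_wpM2l; last exact: aB.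
  by rewrite subr_ge0 wmono.
have : `|w M * S M| <= w M * B.
  by rewrite normrM ger0_norm ?(le_trans w0)//; apply: ler_wpM2l; [exact: le_trans w0 _|exact: aB].
move=> H1 H2; apply: le_trans (ler_normB _ _) _.
have : 0 <= w 0%N * B by rewrite mulr_ge0.
lra.
Qed.

Lemma sum_qpoly_blocks {V : zmodType} n c (g : nat -> V) M :
  \sum_(s < qpoly n c M) g s = \sum_(m < M) \sum_(i < qstep n c m) g (qpoly n c m + i)%N.
Proof.
elim: M => [|M IH]; first by rewrite qpoly0 !big_ord0.
by rewrite qpolyS big_split_ord/= IH big_ord_recr.
Qed.

(** The weight spreads each term over the integers from $q(m)$ to $q(m+1)-1$; moving by [i] inside
    this range changes the phase, up to integers, by $(\alpha-a)i$. *)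
Lemma qpoly_trivial_arc {R : realType} n c M (alpha phi : R) (a : int) :
  `|\sum_(m < M) (qstep n c m)%:R * ecos (alpha * (qpoly n c m)%:R + phi) -
    \sum_(s < qpoly n c M) ecos (alpha * s%:R + phi)| <=
  8 * `|alpha - a%:~R| * (qstep n c M)%:R * (qpoly n c M)%:R.
Proof.
rewrite (sum_qpoly_blocks n c (fun s => ecos (alpha * s%:R + phi))) -sumrB.
apply: (@le_trans _ _ (\sum_(s < qpoly n c M) 8 * `|alpha - a%:~R| * (qstep n c M)%:R)); last first.
  by rewrite sumr_const card_ord -[leLHS]mulr_natr.
rewrite (sum_qpoly_blocks n c (fun=> 8 * `|alpha - a%:~R| * (qstep n c M)%:R)).
apply: le_trans (ler_norm_sum _ _ _) _; apply: ler_sum => m _.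
have -> : (qstep n c m)%:R * ecos (alpha * (qpoly n c m)%:R + phi) =
    \sum_(i < qstep n c m) ecos (alpha * (qpoly n c m)%:R + phi).
  by rewrite sumr_const card_ord mulr_natl.
rewrite -sumrB.
apply: le_trans (ler_norm_sum _ _ _) _; apply: ler_sum => i _.
rewrite -[X in `|X - _|](ecosDz _ (a * i%:Z)).
apply: le_trans (dist_ecos_le _ _) _; rewrite -mulrA; apply: ler_wpM2l => //.
rewrite intrM -pmulrn natrD.
rewrite [X in `|X|](_ : _ = (a%:~R - alpha) * i%:R); last by ring.
rewrite normrM distrC normr_nat; apply: ler_wpM2l => //.
by rewrite ler_nat ltnW// (leq_trans (ltn_ord i))// leq_qstep// ltnW.
Qed.

(** Close to an integer the two sums are compared directly. Elsewhere both are small: the weighted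
    one by equidistribution and summation by parts, the interval as a geometric sum. *)
Lemma qpoly_interval_transform {R : realType} (n E : nat) : (0 < E)%N ->
  exists L : nat, (0 < L)%N /\ forall c : nat -> nat, (0 < c n)%N ->
    (forall m m', qpoly n c m = qpoly n c m' %[mod L * (n.+1)`! * c n] ->
       m = m' %[mod L * (n.+1)`! * c n]) ->
    exists M0 : nat, forall (M : nat), (M0 < M)%N -> forall alpha phi : R,
      E%:R * `|\sum_(m < M) (qstep n c m)%:R * ecos (alpha * (qpoly n c m)%:R + phi) -
               \sum_(s < qpoly n c M) ecos (alpha * s%:R + phi)| <= (qpoly n c M)%:R.
Proof.
(* One 2 from summation by parts, one to get half of the allowed error, and [3 ^ n.+1] from bounding
   [M * w M] by [q M]. *)
move=> E0; pose E1 := (4 * 3 ^ n.+1 * E)%N.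
have E10 : (0 < E1)%N by rewrite !muln_gt0 expn_gt0 E0.
have [L [L0 HL]] := @qpoly_equidistribution R n E1 E10.
exists L; split => // c c0 qinj.
have [C [M1 HC]] := HL c c0 qinj.
set q := qpoly n c; set w := qstep n c.
(* [C] excludes the first alternative of equidistribution far from integers; [2 * E] bounds the
   interval sum by the other half of the error. *)
pose C2 := (C + 2 * E)%N.
exists (M1 + 8 * E * C2 * 3 ^ n.+1 * q 1)%N => M MM alpha phi.
have MM1 : (M1 < M)%N by apply: leq_ltn_trans MM; exact: leq_addr.
have MM2 : (8 * E * C2 * 3 ^ n.+1 * q 1 <= M)%N by apply: leq_trans (ltnW MM); exact: leq_addl.
have M0 : (0 < M)%N by exact: leq_ltn_trans MM1.
have MR : 0 < M%:R :> R by rewrite ltr0n.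
have Mn : 0 < M%:R ^+ n.+1 :> R by rewrite exprn_gt0.
have Mw : (M * w M <= 3 ^ n.+1 * q M)%N by exact: leq_mul_qstep.
have qM : M%:R ^+ n.+1 <= (q M)%:R :> R by rewrite -natrX ler_nat leq_expn_qpoly.
have [[a ha]|far] := pselect (near_int alpha (C2%:R / M%:R ^+ n.+1)).
  have := qpoly_trivial_arc n c M alpha phi a; rewrite -/q -/w.
  move: `|_ - _| (normr_ge0 (alpha - a%:~R)) ha => b b0.
  rewrite ler_pdivlMr// => hb.
  set D := `|_|; move=> HD.
  have wM : 8 * E%:R * C2%:R * (w M)%:R <= M%:R ^+ n.+1 :> R.
    rewrite -natrX -!natrM ler_nat -(leq_pmul2l M0).
    apply: (@leq_trans (8 * E * C2 * (3 ^ n.+1 * q M))); first by rewrite mulnCA leq_mul2l Mw orbT.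
    apply: leq_trans (_ : (8 * E * C2 * 3 ^ n.+1 * q 1) * M ^ n.+1 <= _)%N.
      by rewrite -!mulnA !leq_mul2l qpoly_le// !orbT.
    by rewrite leq_mul2r MM2 orbT.
  apply: le_trans (ler_wpM2l (ler0n R E) HD) _.
  rewrite [leLHS](_ : _ = (8 * E%:R * (w M)%:R * b) * (q M)%:R); last by ring.
  rewrite -[leRHS]mul1r; apply: ler_wpM2r => //.
  rewrite -(ler_pM2r Mn) mul1r -[leLHS]mulrA; apply: le_trans (ler_wpM2l _ hb) _; first by rewrite !mulr_ge0.
  by rewrite mulrAC.
have [near|H2] := HC M alpha MM1.
  case: far; apply: near_int_le near; rewrite ler_pdivlMr// divfK ?lt0r_neq0//.
  by rewrite ler_nat leq_addr.
have [a _ /(_ phi (q M))] := sum_ecos_linear_le alpha.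
set S := `|\sum_(s < q M) _| => aS.
have a_far : C2%:R < `|alpha - a%:~R| * M%:R ^+ n.+1.
  by rewrite -ltr_pdivrMr// ltNge; apply/negP => le; apply: far; exists a.
have S2 : 2 * E%:R * S <= (q M)%:R.
  apply: (@le_trans _ _ (C2%:R * S)); first by apply: ler_wpM2r; rewrite ?normr_ge0// -natrM ler_nat leq_addl.
  apply: le_trans (ler_wpM2r (normr_ge0 _) (ltW a_far)) _.
  by rewrite mulrAC; apply: le_trans qM; rewrite ler_piMl// exprn_ge0.
have E1R : 0 < E1%:R :> R by rewrite ltr0n.
have := @Abel_sum_le R (fun m => (w m)%:R) (fun m => ecos (alpha * (q m)%:R + phi)) (M%:R / E1%:R) M.
set W := `|_| => HW.
have {}HW : W <= 2 * (w M)%:R * (M%:R / E1%:R).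
  apply: HW => //.
    by move=> m m' mm'; rewrite ler_nat leq_qstep.
  by move=> M' M'M; rewrite ler_pdivlMr// mulrC H2.
have : 2 * E%:R * W <= (q M)%:R.
  apply: le_trans (ler_wpM2l _ HW) _; first by rewrite mulr_ge0.
  rewrite mulrA mulrA ler_pdivrMr// -!natrM ler_nat.
  rewrite [leqLHS](_ : _ = 4 * E * (M * w M))%N; last by ring.
  rewrite (_ : q M * E1 = 4 * E * (3 ^ n.+1 * q M))%N; last by rewrite /E1; ring.
  by rewrite leq_mul2l Mw orbT.
move=> W2; apply: le_trans (ler_wpM2l _ (ler_normB _ _)) _ => //; rewrite -/W -/S.
lra.
Qed.

(** * Fourier analysis on the cyclic group *)

Lemma ecos_orthogonality {R : realType} (Q s t : nat) : (s < Q)%N -> (t < Q)%N ->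
  \sum_(j < Q) ecos (j%:R / Q%:R * s%:R - j%:R / Q%:R * t%:R) = (if s == t then Q%:R else 0) :> R.
Proof.
move=> sQ tQ; have Q0 : (0 < Q)%N by exact: leq_ltn_trans tQ.
have [<-|st] := eqVneq s t.
  rewrite (eq_bigr (fun=> 1)) ?sumr_const ?card_ord// => j _.
  by rewrite subrr ecos0.
rewrite -[RHS](@sum_ecos_full_period R Q (s%:Z - t%:Z) 0 Q0).
  by apply: eq_bigr => j _; rewrite intrB -!pmulrn; congr ecos; ring.
rewrite -eqz_mod_dvd !modz_nat !modn_small//.
Qed.

(** Here [P phi] is the real part of $z\,e(\phi)$ for some complex $z$. With $S=\sum_{u\in U}
    e(\theta_u)$ the left side is $|\mathrm{Re}(z\bar S^2)|$ and the double sum on the right is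
    $|S|^2$; treating the two coordinates of $z$ separately costs the factor 2. *)
Lemma character_bilinear_le {R : realType} (I : finType) (U : {pred I}) (P : R -> R) (theta : I -> R) (X : R) :
  (forall phi, P phi = P 0 * ecos phi + P (1 / 4) * esin phi) -> (forall phi, `|P phi| <= X) ->
  `|\sum_(u in U) \sum_(v in U) P (- (theta u + theta v))| <=
  2 * X * \sum_(u in U) \sum_(v in U) ecos (theta u - theta v).
Proof.
move=> PE PX.
pose A := \sum_(u in U) ecos (theta u); pose B := \sum_(u in U) esin (theta u).
have -> : \sum_(u in U) \sum_(v in U) ecos (theta u - theta v) = A ^+ 2 + B ^+ 2.
  rewrite !expr2 !mulr_suml -big_split/=; apply: eq_bigr => u _.
  rewrite !mulr_sumr -big_split/=; apply: eq_bigr => v _.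
  by rewrite ecosB.
have ecosN (x : R) : ecos (- x) = ecos x by rewrite /ecos mulrN cosN.
have esinN (x : R) : esin (- x) = - esin x by rewrite /esin mulrN sinN.
have -> : \sum_(u in U) \sum_(v in U) P (- (theta u + theta v)) =
    P 0 * (A ^+ 2 - B ^+ 2) - P (1 / 4) * (2 * (A * B)).
  have -> : 2 * (A * B) = A * B + B * A by ring.
  rewrite !expr2 mulrBr mulrDr !mulr_suml !mulr_sumr opprD addrA -!sumrB.
  apply: eq_bigr => u _.
  rewrite !mulr_sumr -!sumrB; apply: eq_bigr => v _.
  rewrite PE ecosN esinN ecosD esinD; ring.
apply: le_trans (ler_normB _ _) _; rewrite !normrM.
have A2 := sqr_ge0 A; have B2 := sqr_ge0 B.
have -> : 2 * X * (A ^+ 2 + B ^+ 2) = X * (A ^+ 2 + B ^+ 2) + X * (A ^+ 2 + B ^+ 2) by ring.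
apply: lerD; apply: ler_pM => //; rewrite -?normrM.
  by rewrite ler_norml; lra.
have := sqr_ge0 (A + B); have := sqr_ge0 (A - B); rewrite sqrrB sqrrD -[_ *+ 2]mulr_natl.
by rewrite ler_norml; lra.
Qed.

(** Fourier inversion modulo [Q], where sums of two elements do not wrap around, followed by
    Parseval's identity for [U]. *)
Lemma sumset_bilinear_le {R : realType} (N Q : nat) (U : {pred 'I_N}) (K : nat -> R) (X : R) :
  (2 * N <= Q)%N ->
  (forall alpha phi, `|\sum_(s < Q) K s * ecos (alpha * s%:R + phi)| <= X) ->
  `|\sum_(u in U) \sum_(v in U) K (u + v)%N| <= 2 * X * #|U|%:R.
Proof.
move=> NQ KX.
have [U0|/card_gt0P[u0 _]] := posnP #|U|.
  rewrite U0 mulr0 big1 ?normr0// => u uU.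
  by move: U0 => /card0_eq/(_ u); rewrite uU.
have Q0 : (0 < Q)%N.
  by apply: leq_trans NQ; rewrite muln_gt0/=; apply: leq_ltn_trans (ltn_ord u0).
have QR : 0 < Q%:R :> R by rewrite ltr0n.
pose F j phi := \sum_(s < Q) K s * ecos (j / Q%:R * s%:R + phi) : R.
pose th (j : nat) (u : 'I_N) : R := j%:R / Q%:R * u%:R.
have uvQ (u v : 'I_N) : (u + v < Q)%N.
  by apply: leq_trans NQ; rewrite mul2n -addnn -addSn leq_add// ltnW.
have FK : Q%:R * \sum_(u in U) \sum_(v in U) K (u + v)%N =
    \sum_(j < Q) \sum_(u in U) \sum_(v in U) F j%:R (- (th j u + th j v)).
  rewrite [RHS]exchange_big mulr_sumr; apply: eq_bigr => u _ /=.
  rewrite [RHS]exchange_big mulr_sumr; apply: eq_bigr => v _ /=.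
  rewrite exchange_big/= (bigD1 (Ordinal (uvQ u v)))//= [X in _ + X]big1 ?addr0 => [|s].
    rewrite -mulr_sumr mulrC; congr (_ * _).
    rewrite -[LHS](_ : (if (u + v)%N == (u + v)%N then Q%:R else 0) = _); last by rewrite eqxx.
    rewrite -ecos_orthogonality//; apply: eq_bigr => j _.
    by rewrite /th -mulrDr natrD.
  rewrite -val_eqE/= => /negbTE s_uv; rewrite -mulr_sumr.
  rewrite [X in _ * X](_ : _ = 0) ?mulr0//.
  rewrite -[RHS](_ : (if s == (u + v)%N :> nat then Q%:R else 0) = _); last by rewrite s_uv.
  rewrite -ecos_orthogonality//; apply: eq_bigr => j _.
  by rewrite /th -mulrDr natrD.
have E2 : \sum_(j < Q) \sum_(u in U) \sum_(v in U) ecos (th j u - th j v) = Q%:R * #|U|%:R.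
  rewrite exchange_big -sum1_card natr_sum mulr_sumr; apply: eq_bigr => u uU /=.
  rewrite exchange_big/= (bigD1 u)//= [X in _ + X]big1 ?addr0 => [|v /andP[_ vu]].
    by rewrite ecos_orthogonality// ?eqxx ?mulr1//; have := uvQ u u; lia.
  have uQ (x : 'I_N) : (x < Q)%N by have := uvQ x x; lia.
  by rewrite ecos_orthogonality// val_eqE eq_sym (negbTE vu).
rewrite -(ler_pM2l QR) -{1}(gtr0_norm QR) -normrM FK mulrCA -E2 mulr_sumr.
apply: le_trans (ler_norm_sum _ _ _) _; apply: ler_sum => j _.
apply: character_bilinear_le => [phi|phi]; last exact: KX.
rewrite /F !mulr_suml -big_split/=; apply: eq_bigr => s _.
rewrite addr0 ecosDquarter ecosD; ring.
Qed.

(** * Polynomial values as sums of two elements of a dense set *)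

Lemma ltn_qpoly n c : (0 < c n)%N -> {homo qpoly n c : m m' / (m < m')%N}.
Proof.
move=> c0 m m' mm'; rewrite /qpoly !big_ord_recr/= -addnS leq_add//.
  by apply: leq_sum => j _; rewrite leq_mul2l leq_exp2r// ltnW ?orbT.
by rewrite ltn_mul2l c0 ltn_exp2r.
Qed.

Lemma qpoly_inj n c : (0 < c n)%N -> injective (qpoly n c).
Proof.
move=> c0 m m' E; apply/eqP; have := ltn_qpoly n c c0.
by case: ltngtP => // lt /(_ _ _ lt); rewrite E ltnn.
Qed.

(** Let [K] be the weighted indicator of the values of [q] minus 1. Without solutions, [K (u + v)]
    is -1 off the diagonal, so its sum over pairs is nearly $-|U|^2$, against the bound given by its
    small Fourier transform. *)
Lemma dense_set_polynomial_sum {R : realType} (n : nat) (delta : R) : 0 < delta ->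
  exists L : nat, (0 < L)%N /\ forall c : nat -> nat, (0 < c n)%N ->
    (forall m m', qpoly n c m = qpoly n c m' %[mod L * (n.+1)`! * c n] ->
       m = m' %[mod L * (n.+1)`! * c n]) ->
    exists N0 : nat, forall (N : nat) (U : {pred 'I_N.+1}), (N0 <= N)%N ->
      delta * N%:R <= #|U|%:R ->
      exists u v m, [/\ u \in U, v \in U, u != v & (u + v)%N = qpoly n c m].
Proof.
move=> delta0; pose A := (3 ^ n.+1)%N.
have A0 : (0 < A)%N by rewrite expn_gt0.
(* Chosen so that $3q(M)/E$ falls below $\delta N$, given $q(M)\le 3(1+A)N$. *)
pose E := (Num.bound ((9 * (1 + A))%:R / delta)).+1.
have HE : (9 * (1 + A))%:R < delta * E%:R.
  rewrite mulrC -ltr_pdivrMr//; apply: lt_trans (archi_boundP _) _; first by rewrite divr_ge0// ltW.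
  by rewrite ltr_nat.
have [L [L0 HL]] := @qpoly_interval_transform R n E isT.
exists L; split => // c c0 qinj.
have [M1 HM] := HL c c0 qinj.
set q := qpoly n c; set w := qstep n c.
pose M2 := (M1 + A * E)%N.
exists (q M2).+1 => N U NN0 dens.
have N0 : (0 < N)%N by exact: leq_trans NN0.
have exM : exists m, (2 * N.+1 <= q m)%N.
  exists (2 * N.+1)%N; apply: leq_trans (leq_expn_qpoly n c _ c0).
  by rewrite expnS leq_pmulr// expn_gt0.
(* $q(M)$ must exceed all sums of two elements, and minimality of [M] keeps it of order [N]. *)
case: (ex_minnP exM) => M NQ Mmin.
have M2M : (M2 < M)%N.
  rewrite ltnNge; apply/negP => /(leq_qpoly n c) qMM2.
  by have := leq_trans NQ qMM2; rewrite -/q; lia.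
have MM1 : (M1 < M)%N by apply: leq_ltn_trans M2M; exact: leq_addr.
have AEM : (A * E < M)%N by apply: leq_ltn_trans M2M; exact: leq_addl.
have QN : (q M <= (1 + A) * (3 * N))%N.
  case: M NQ Mmin M2M MM1 AEM => // M _ Mmin _ _ AEM.
  have qM : (q M <= 3 * N)%N.
    have : ~~ (2 * N.+1 <= q M)%N by apply/negP => /Mmin; rewrite ltnn.
    lia.
  have M0 : (0 < M)%N by move: AEM; rewrite ltnS; apply: leq_trans; rewrite muln_gt0 A0.
  have wM : (w M <= A * q M)%N.
    by apply: leq_trans (leq_mul_qstep n c M); rewrite leq_pmull.
  rewrite /q qpolyS mulnDl mul1n leq_add//.
  by apply: leq_trans wM _; rewrite leq_mul2l qM orbT.
have wQ : (E * w M <= q M)%N.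
  rewrite -(leq_pmul2l A0); apply: leq_trans (leq_mul_qstep n c M).
  by rewrite mulnA leq_mul2r ltnW ?orbT.
pose K1 (s : nat) := (\sum_(m < M) (q m == s) * w m)%N.
have K1w s : (K1 s <= w M)%N.
  have [[m /eqP qm]|noq] := pselect (exists m : 'I_M, q m == s).
    rewrite /K1 (bigD1 m)//= big1 ?addn0 => [|m' mm'].
      by rewrite qm eqxx mul1n leq_qstep// ltnW.
    by rewrite -qm (inj_eq (qpoly_inj n c c0)) val_eqE (negbTE mm').
  rewrite /K1 big1// => m _; case: eqP => // qm; case: noq; exists m; exact/eqP.
pose K s : R := (K1 s)%:R - 1.
have KX alpha phi : `|\sum_(s < q M) K s * ecos (alpha * s%:R + phi)| <= (q M)%:R / E%:R.
  rewrite ler_pdivlMr ?ltr0n// mulrC; apply: le_trans (HM M MM1 alpha phi).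
  apply: ler_wpM2l => //; rewrite le_eqVlt; apply/orP; left; apply/eqP; congr (Num.norm _).
  under eq_bigr do rewrite mulrBl mul1r.
  rewrite sumrB; congr (_ - _).
  under eq_bigr do rewrite natr_sum mulr_suml.
  rewrite exchange_big/=; apply: eq_bigr => m _.
  have mQ : (q m < q M)%N by exact: ltn_qpoly.
  rewrite (bigD1 (Ordinal mQ))//= eqxx mul1n big1 ?addr0// => s.
  by rewrite -val_eqE/= eq_sym => /negbTE ->; rewrite mul0n mul0r.
have := sumset_bilinear_le N.+1 (q M) U K _ NQ KX.
apply: contraPP => nosol; apply/negP; rewrite -ltNge.
have uv0 (u v : 'I_N.+1) : u \in U -> v \in U -> u != v -> K1 (u + v)%N = 0%N.
  move=> uU vU uv; rewrite /K1 big1// => m _; case: eqP => // qm.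
  by case: nosol; exists u, v, m.
have S_le : \sum_(u in U) \sum_(v in U) K (u + v)%N <= #|U|%:R * (w M)%:R - #|U|%:R * #|U|%:R.
  rewrite -mulrBr mulr_natl -sumr_const; apply: ler_sum => u uU.
  rewrite sumrB sumr_const lerD2r (bigD1 u)//= big1 ?addr0 ?ler_nat ?K1w// => v /andP[vU vu].
  by rewrite uv0// eq_sym.
set S := \sum_(u in U) _ in S_le *.
have U0 : 0 < #|U|%:R :> R by apply: lt_le_trans dens; rewrite mulr_gt0// ltr0n.
have ER : 0 < E%:R :> R by rewrite ltr0n.
(* The term [w M] is the contribution of the diagonal, where [u + u] may be a value of [q]. *)
suff : 2 * ((q M)%:R / E%:R) + (w M)%:R < #|U|%:R :> R.
  move=> H; apply: (@lt_le_trans _ _ (- S)); last by rewrite -normrN ler_norm.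
  have : #|U|%:R * (2 * ((q M)%:R / E%:R) + (w M)%:R) < #|U|%:R * #|U|%:R :> R by rewrite ltr_pM2l.
  lra.
rewrite -(ltr_pM2l ER); apply: (@le_lt_trans _ _ (3 * (q M)%:R)).
  have : E%:R * (w M)%:R <= (q M)%:R :> R by rewrite -natrM ler_nat.
  have : E%:R * ((q M)%:R / E%:R) = (q M)%:R :> R by rewrite mulrC divfK ?lt0r_neq0.
  lra.
apply: (@le_lt_trans _ _ ((9 * (1 + A))%:R * N%:R)).
  rewrite -!natrM ler_nat; move: QN; move: (1 + A)%N (q M) => B Q; nia.
apply: (@lt_le_trans _ _ (delta * E%:R * N%:R)); first by rewrite ltr_pM2r// ltr0n.
by rewrite mulrAC mulrC ler_pM2l.
Qed.

(** * Reduction to the case of natural coefficients *)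

(** Horner's scheme: a positive integer value times [n] exceeds any fixed constant term once [n] is
    large. *)
Lemma horner_eventually_gt0 (p : {poly int}) : 0 < lead_coef p ->
  exists n0 : nat, forall n : nat, (n0 <= n)%N -> 0 < p.[n%:Z].
Proof.
elim/poly_ind: p => [|p c IH]; first by rewrite lead_coef0 ltxx.
have [->|p0] := eqVneq p 0.
  rewrite mul0r add0r lead_coefC => c0; exists 0%N => n _.
  by rewrite hornerC.
rewrite lead_coefDl ?size_mulX ?size_polyC//; last first.
  by apply: leq_ltn_trans (leq_b1 _) _; rewrite ltnS lt0n size_poly_eq0.
rewrite lead_coefMX => /IH [n0 Hn0].
exists (n0 + `|c|.+1)%N => n nn0.
rewrite hornerMXaddC.
have := Hn0 n (leq_trans (leq_addr _ _) nn0).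
have : (`|c| < n)%N by apply: leq_trans nn0; apply: leq_addl.
move: p.[_] => x; nia.
Qed.

Lemma lead_coef_nderivn_gt0 (p : {poly int}) (j : nat) :
  0 < lead_coef p -> (j < size p)%N -> 0 < lead_coef p^`N(j).
Proof.
move=> lp jp.
have cj : p^`N(j)`_(size p - j.+1) = lead_coef p *+ 'C((size p).-1, j).
  have jE : (j + (size p - j.+1) = (size p).-1)%N by case: (size p) jp => // k; rewrite ltnS subSS => /subnKC.
  by rewrite coef_nderivn jE lead_coefE.
have cj0 : 0 < p^`N(j)`_(size p - j.+1) by rewrite cj pmulrn_rgt0// bin_gt0; case: (size p) jp.
have sz : size p^`N(j) = (size p - j)%N.
  apply/eqP; rewrite eqn_leq; apply/andP; split.
    apply/leq_sizeP => i ji; by rewrite coef_nderivn nth_default ?mul0rn// -leq_subLR.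
  rewrite leqNgt; apply/negP => lt; move: cj0; rewrite nth_default ?ltxx//.
  by rewrite -subnSK in lt.
by rewrite lead_coefE sz -subnS.
Qed.

(** The normalised derivatives at [n] are the coefficients of $p(n+x)$. *)
Lemma nderivn_eventually_gt0 (p : {poly int}) : 0 < lead_coef p ->
  exists n0 : nat, forall n j : nat, (n0 <= n)%N -> (j < size p)%N -> 0 < p^`N(j).[n%:Z].
Proof.
move=> lp; suff H s : (s <= size p)%N ->
    exists n0 : nat, forall n j : nat, (n0 <= n)%N -> (j < s)%N -> 0 < p^`N(j).[n%:Z] by exact: H.
elim: s => [|s IH] sp; first by exists 0%N.
have [n0 Hn0] := IH (ltnW sp).
have [n1 Hn1] := horner_eventually_gt0 _ (lead_coef_nderivn_gt0 _ _ lp sp).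
exists (maxn n0 n1) => n j; rewrite geq_max => /andP[n0n n1n].
by rewrite ltnS leq_eqVlt => /predU1P[->|]; [exact: Hn1|exact: Hn0].
Qed.

Lemma dvdz_horner_diff (p : {poly int}) (x h : int) : (h %| p.[x + h] - p.[x])%Z.
Proof.
elim/poly_ind: p => [|p c IH]; first by rewrite !horner0 subrr dvdz0.
rewrite !hornerMXaddC.
have -> : p.[x + h] * (x + h) + c - (p.[x] * x + c) =
  (p.[x + h] - p.[x]) * (x + h) + p.[x] * h by ring.
by apply: rpredD; [exact: dvdz_mulr|exact: dvdz_mull].
Qed.

Lemma cvg_pinfty_lead_coef {R : realType} (p : {poly int}) :
  (map_poly (intr : int -> R) p).[x] @[x --> +oo] --> +oo ->
  (1 < size p)%N /\ 0 < lead_coef p.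
Proof.
move=> /cvgryPge plim.
have big (B : int) (n0 : nat) : exists2 n, (n0 <= n)%N & B <= p.[n%:Z].
  have [M [_ HM]] := plim B%:~R.
  pose n := (n0 + Num.bound M)%N; exists n; first exact: leq_addr.
  have := HM n%:~R; rewrite horner_map ler_int; apply.
  have [M0|M0] := ltP M 0; first by apply: lt_le_trans M0 _; rewrite ler0z.
  by apply: lt_le_trans (archi_boundP M0) _; rewrite -pmulrn ler_nat leq_addl.
have sp : (1 < size p)%N.
  rewrite ltnNge; apply/negP => /size1_polyC pC.
  by have [n _] := big (p`_0 + 1) 0%N; rewrite pC hornerC coefC eqxx; lia.
split => //; rewrite lt0r lead_coef_eq0 -size_poly_eq0 -lt0n (ltnW sp)/=.
rewrite leNgt; apply/negP => lp.
have [|n0 Hn0] := horner_eventually_gt0 (- p); first by rewrite lead_coefN oppr_gt0.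
have [n /Hn0] := big 0 n0; rewrite hornerN oppr_gt0 => lt0 /(lt_le_trans lt0).
by rewrite ltxx.
Qed.

(** The difference of two values is $(m-m')(1+Kt)$, and $1+Kt$ is coprime to [K], hence to [D]. *)
Lemma qpoly_inj_mod (n : nat) (c : nat -> nat) (K D e : nat) :
  c 0%N = 1%N -> (forall j, (K %| c j.+1)%N) -> (D %| K ^ e)%N ->
  forall m m', qpoly n c m = qpoly n c m' %[mod D] -> m = m' %[mod D].
Proof.
move=> c0 Kc DK m m'.
wlog mm' : m m' / (m' <= m)%N.
  by move=> H; case: (leqP m' m) => [|/ltnW] le E; [|symmetry]; apply: H.
move=> /eqP; rewrite eqn_mod_dvd ?leq_qpoly// => Dq; apply/eqP; rewrite eqn_mod_dvd//.
have [t qE] : exists t, (qpoly n c m - qpoly n c m' = (m - m') * (1 + K * t))%N.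
  rewrite /qpoly !big_ord_recl/= c0 !mul1n !expn1.
  have le : (\sum_(i < n) c (bump 0 i) * m' ^ (bump 0 i).+1 <=
             \sum_(i < n) c (bump 0 i) * m ^ (bump 0 i).+1)%N.
    by apply: leq_sum => j _; rewrite leq_mul2l leq_exp2r// mm' orbT.
  have /dvdnP[t tE] : ((m - m') * K %| \sum_(i < n) c (bump 0 i) * m ^ (bump 0 i).+1 -
             \sum_(i < n) c (bump 0 i) * m' ^ (bump 0 i).+1)%N.
    rewrite -sumnB => [|j _]; last by rewrite leq_mul2l leq_exp2r// mm' orbT.
    apply: dvdn_sum => j _; rewrite -mulnBr mulnC dvdn_mul// ?Kc//.
    by rewrite subn_exp dvdn_mulr.
  exists t; rewrite mulnDr muln1 mulnA (mulnC _ t) -tE; move: le mm'; do 2!move: (\sum_(_ < n) _)%N => ?; lia.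
move: Dq; rewrite qE Gauss_dvdl//.
apply: coprime_dvdl DK _; apply: coprimeXl.
by rewrite /coprime addnC mulnC gcdnMDl gcdn1.
Qed.

Lemma ltn_limn_esup {R : realType} (u : nat -> \bar R) (x : \bar R) (n0 : nat) :
  (x < limn_esup u)%E -> exists2 n, (n0 <= n)%N & (x < u n)%E.
Proof.
move=> xu.
have : (x < ereal_sup [set u n | n in [set n | (n0 <= n)%N]])%E.
  apply: lt_le_trans xu _; apply: ereal_inf_lbound.
  by exists [set n | (n0 <= n)%N] => //; exact: nbhs_infty_ge.
by move=> /ereal_sup_gt[_ [n n0n <-] xun]; exists n.
Qed.

Lemma card_ap_segment_le (A : set nat) (b d N : nat) (U : {pred 'I_N.+1}) :
  (forall u : 'I_N.+1, (0 < u)%N -> A (b + u * d)%N -> u \in U) ->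
  ((#|` fset_set (A `&` ap_segment b d N)|)%fset <= #|U|)%N.
Proof.
move=> AU.
have fin : finite_set (A `&` ap_segment b d N).
  apply: sub_finite_set (@subIsetr _ _ _) _; apply: finite_image.
  by apply: (sub_finite_set _ (finite_II N.+1)) => k /= /andP[].
rewrite cardE -(size_map (fun u : 'I_N.+1 => b + u * d)%N).
apply: uniq_leq_size; first exact: fset_uniq.
move=> x; rewrite in_fset_set// inE => -[Ax [k /= /andP[k0 kN] kx]].
have kN' : (k < N.+1)%N by [].
apply/mapP; exists (Ordinal kN') => //=; rewrite mem_enum AU//=.
by rewrite kx.
Qed.

(** Taylor expansion at [n0] with step [e]: the linear coefficient becomes $a_1e=d$, so dividing by
    [d] leaves linear coefficient 1 and higher ones divisible by [K]. *)
Lemma shifted_polynomial (p : {poly int}) (n0 n L : nat) : (0 < L)%N ->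
  size p = n.+2 -> (2 %| p.[n0%:Z])%Z ->
  (forall j, (j < n.+2)%N -> 0 < p^`N(j).[n0%:Z]) ->
  exists (b d e : nat) (c : nat -> nat), [/\ (0 < b)%N, (0 < d)%N, (0 < c n)%N,
    (forall m m', qpoly n c m = qpoly n c m' %[mod L * (n.+1)`! * c n] ->
       m = m' %[mod L * (n.+1)`! * c n]) &
    forall m, p.[(n0 + e * m)%:Z] = (2 * b + d * qpoly n c m)%:Z].
Proof.
move=> L0 sp p_even pos.
pose a j := `|p^`N(j).[n0%:Z]|%N.
have aE j : (j < n.+2)%N -> (a j)%:Z = p^`N(j).[n0%:Z].
  by move=> jn; rewrite gez0_abs// ltW// pos.
have a0 j : (j < n.+2)%N -> (0 < a j)%N.
  by move=> jn; rewrite -ltz_nat aE// pos.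
have [K [K0 LK aK]] : exists K, [/\ 0 < K, L * (n.+1)`! * a n.+1 %| K & a 1 %| K]%N.
  exists (L * (n.+1)`! * a n.+1 * a 1)%N.
  by rewrite dvdn_mulr// dvdn_mull// !muln_gt0 L0 fact_gt0 !a0.
(* From $a_{j+1}(a_1K)^{j+1}=a_1^2K\cdot c_j$. Although [c n] contains powers of [K], the modulus
   still divides a power of [K], so the choice is not circular. *)
pose c j := if j is j'.+1 then (a j.+1 * a 1%N ^ j' * K ^ j)%N else 1%N.
have pE : p.[n0%:Z] = (a 0%N)%:Z by rewrite aE// nderivn0.
have [b bE] : exists b, a 0%N = (2 * b)%N.
  by move: p_even; rewrite pE => /dvdnP[b E]; exists b; rewrite mulnC; exact: E.
exists b, (a 1%N * (a 1%N * K))%N, (a 1%N * K)%N, c; split.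
- by have := a0 0%N isT; rewrite bE muln_gt0.
- by rewrite !muln_gt0 K0 a0.
- by rewrite /c; case: (n) a0 => // k a0; rewrite !muln_gt0 !expn_gt0 K0 !a0.
- apply: (@qpoly_inj_mod n c K _ (n + n).+1) => //.
    by move=> j; rewrite dvdn_mull// expnS dvdn_mulr.
  rewrite /c; case: (n) LK => [|k] LK.
    by rewrite muln1 expn1; apply: dvdn_trans LK; exact: dvdn_mulr.
  rewrite (mulnA _ _ (K ^ _)%N) (mulnA _ _ (a 1 ^ _)%N) [X in (_ %| X)%N]expnS expnD mulnA dvdn_mul// dvdn_mul//.
  by rewrite expnS dvdn_mull// dvdn_exp2r.
- move=> m; rewrite PoszD nderiv_taylor ?sp; last exact: mulrC.
  rewrite big_ord_recl/= expr0 mulr1 nderivn0 pE bE PoszD; congr (_ + _).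
  rewrite /qpoly big_distrr/= -[RHS]natz natr_sum; apply: eq_bigr => j _.
  have PoszX (x k : nat) : x%:Z ^+ k = (x ^ k)%N%:Z by rewrite -!natz natrX.
  have jn : (bump 0 j < n.+2)%N by rewrite /bump/= add1n ltnS.
  rewrite natz -(aE _ jn) PoszX -PoszM /bump/= add1n; congr Posz.
  case: j {jn} => -[|j] _ /=; rewrite /c/= !expnS ?expn0 ?expnMn; ring.
Qed.

Theorem theorem1p6 (R : realType) (delta : R) (p : {poly int})
    (delta_gt0 : 0 < delta)
    (p_pinfty : (map_poly (intr : int -> R) p).[x] @[x --> +oo] --> +oo)
    (p_even : exists n : nat, (0 < n)%N /\ (2 %| p.[n%:Z])%Z) :
  exists b d : nat, (0 < b)%N /\ (0 < d)%N /\
    forall A : set nat, A `<=` [set n | (0 < n)%N] ->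
      (delta%:E < upper_density_ap R b d A)%E ->
      exists x y : nat, A x /\ A y /\ x <> y /\
        exists n : nat, (0 < n)%N /\ (x + y)%N%:Z = p.[n%:Z].
Proof.
have [sp lp] := cvg_pinfty_lead_coef p p_pinfty.
have [n1 Hn1] := nderivn_eventually_gt0 p lp.
case: p_even => n2 [n20 p_even].
(* An even shift keeps the value even and passes the threshold [n1]. *)
pose n0 := (n2 + 2 * n1)%N.
have p_even0 : (2 %| p.[n0%:Z])%Z.
  rewrite -[p.[_]](subrK p.[n2%:Z]) rpredD//.
  by apply: dvdz_trans (dvdz_horner_diff p n2%:Z (2 * n1)%N%:Z); rewrite PoszM dvdz_mulr.
have [n pn] : exists n, size p = n.+2 by exists (size p).-2; case: (size p) sp => [|[|]].
have [L [L0 HL]] := dense_set_polynomial_sum n delta delta_gt0.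
have [||||b [d [e [c [b0 d0 c0 cinj pE]]]]] := shifted_polynomial p n0 n L => //.
  by move=> j jn; apply: Hn1; rewrite ?pn// /n0; lia.
have [N0 HN] := HL c c0 cinj.
(* Asking for [N] beyond [N0.+1] also makes it positive, so that the density can be multiplied
   out. *)
exists b, d; split => //; split => // A _ /(ltn_limn_esup _ _ N0.+1)[N N0N].
rewrite lte_fin ltr_pdivlMr ?ltr0n ?(leq_trans _ N0N)// => dN.
pose U : {pred 'I_N.+1} := [pred u : 'I_N.+1 | `[< A (b + u * d)%N >]].
have [|u [v [m [/asboolP uA /asboolP vA uv uvm]]]] := HN N U (ltnW N0N).
  apply: le_trans (ltW dN) _; rewrite ler_nat; apply: card_ap_segment_le => u _ Au.
  exact/asboolP.
exists (b + u * d)%N, (b + v * d)%N; split => //; split => //; split.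
  by move=> /addnI/eqP; rewrite eqn_pmul2r// => /eqP/val_inj/eqP; apply/negP.
exists (n0 + e * m)%N; split; first by rewrite addn_gt0 addn_gt0 n20.
by rewrite pE -uvm; congr Posz; ring.
Qed.
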